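(* Let $\psi:M^{2}\rightarrow \mathbb{L}^4$ be a spacelike surface which factors through the future lightcone $\Lambda^{+}$, i.e. $\psi(M^2)\subset\Lambda^+$. Then $$ \xi=\psi\quad \text{and}\quad \eta=\frac{1+\| \nabla\psi_{0}\|^2 }{2\,\psi_{0}^2}\, \xi -\frac{1}{\psi_{0}}\Big(\partial_{0}\circ \psi +\psi_{*}(\nabla \psi_{0})\Big) $$ are two lightlike normal vector fields along $\psi$ with $\langle \xi, \eta \rangle = 1$.
   Context: $\mathbb{L}^4$ is Lorentz-Minkowski spacetime: $\mathbb{R}^4$ with the metric $\langle\,,\,\rangle=-(dx_0)^2+(dx_1)^2+(dx_2)^2+(dx_3)^2$. A spacelike surface is a smooth immersion $\psi:M^2\to\mathbb{L}^4$ of a connected $2$-dimensional smooth manifold such that the induced metric is Riemannian. $\Lambda^+=\{v\in\mathbb{L}^4:\langle v,v\rangle=0,\ v_0>0\}$. $\partial_0=\partial/\partial x_0$, $\partial_0\circ\psi$ is its restriction along $\psi$, $\psi_0$ is the $x_0$-component of $\psi$; $\nabla\psi_0$ and $\|\cdot\|$ are the gradient and norm for the induced metric. A vector field along $\psi$ is lightlike if it is nowhere zero and its square $\langle\cdot,\cdot\rangle$ vanishes identically. *)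

(* Defs.v *)
From HB Require Import structures.
From mathcomp Require Import all_boot all_order all_algebra.
From mathcomp Require Import all_classical all_reals all_analysis.

Set Implicit Arguments.
Unset Strict Implicit.
Unset Printing Implicit Defensive.

Import Order.TTheory GRing.Theory Num.Theory.
Import numFieldNormedType.Exports.

Local Open Scope classical_set_scope.
Local Open Scope ring_scope.

(* Only ever used with U open, where continuity and differentiability at the
   points of U do not depend on the values of f outside U. *)
Fixpoint Ck_on (R : realType) (V W : normedModType R) (k : nat) (U : set V)
    (f : V -> W) : Prop :=
  if k is k'.+1 then
    (forall x, U x -> differentiable f x) /\
    (forall v : V, Ck_on k' U (fun x => 'D_v f x))
  else forall x, U x -> {for x, continuous f}.

Definition smooth_on (R : realType) (V W : normedModType R) (U : set V)
    (f : V -> W) : Prop :=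
  forall k, Ck_on k U f.

(* Homeomorphism from an open subset of M onto an open subset of R^n; the two
   maps are total, with irrelevant values outside these sets. *)
Record chart (R : realType) (n : nat) (M : topologicalType) := Chart {
  chart_dom : set M;
  chart_map :> M -> 'rV[R]_n;
  chart_inv : 'rV[R]_n -> M;
  chart_dom_open : open chart_dom;
  chart_codom_open : open (chart_map @` chart_dom);
  chart_mapK : forall p, chart_dom p -> chart_inv (chart_map p) = p;
  chart_map_continuous : forall p, chart_dom p -> {for p, continuous chart_map};
  chart_inv_continuous : forall x, (chart_map @` chart_dom) x ->
    {for x, continuous chart_inv}
}.

Definition chart_codom (R : realType) (n : nat) (M : topologicalType)
    (c : chart R n M) : set 'rV[R]_n :=
  c @` chart_dom c.

(* The atlas need not be maximal: smoothness of maps is the same for an atlas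
   and for the maximal atlas containing it. *)
Record smoothManifold (R : realType) (n : nat) := SmoothManifold {
  manifold_space :> topologicalType;
  manifold_hausdorff : hausdorff_space manifold_space;
  manifold_second_countable : @second_countable manifold_space;
  atlas : set (chart R n manifold_space);
  atlas_cover : forall p : manifold_space,
    exists2 c, atlas c & chart_dom c p;
  atlas_compat : forall c c', atlas c -> atlas c' ->
    smooth_on (c @` (chart_dom c `&` chart_dom c')) (c' \o chart_inv c)
}.

Definition smooth_map (R : realType) (n : nat) (M : smoothManifold R n)
    (W : normedModType R) (f : M -> W) : Prop :=
  forall c, atlas (s := M) c -> smooth_on (chart_codom c) (f \o chart_inv c).

Definition chart_at (R : realType) (n : nat) (M : smoothManifold R n) (p : M)
    : chart R n M :=
  s2val (cid2 (atlas_cover p)).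

(* The tangent space T_p M is represented by R^n, a tangent vector being given
   by its components in the chart [chart_at p]. *)
Definition tangent (R : realType) (n : nat) (M : smoothManifold R n) (p : M) :=
  'rV[R]_n.

(* The differential f_* : T_p M -> T_(f p) W = W. *)
Definition mdiff (R : realType) (n : nat) (M : smoothManifold R n)
    (W : normedModType R) (f : M -> W) (p : M) (v : tangent p) : W :=
  'd (f \o chart_inv (chart_at p)) (chart_at p p) v.

(* L^4 is ['rV_4], with coordinates (x_0, x_1, x_2, x_3). *)
Definition lorentz (R : realType) (u v : 'rV[R]_4) : R :=
  - (u 0 0 * v 0 0) + u 0 1 * v 0 1 + u 0 2%:R * v 0 2%:R
    + u 0 3%:R * v 0 3%:R.

Definition future_lightcone (R : realType) : set 'rV[R]_4 :=
  [set v | lorentz v v = 0 /\ 0 < v 0 0].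

Definition partial0 (R : realType) : 'rV[R]_4 := delta_mx 0 0.

Definition induced_metric (R : realType) (n : nat) (M : smoothManifold R n)
    (psi : M -> 'rV[R]_4) (p : M) (v w : tangent p) : R :=
  lorentz (mdiff psi v) (mdiff psi w).

Definition spacelike_surface (R : realType) (M : smoothManifold R 2)
    (psi : M -> 'rV[R]_4) : Prop :=
  [/\ connected [set: M],
      smooth_map psi,
      forall p : M, injective (@mdiff R 2 M _ psi p) &
      forall (p : M) (v : tangent p), v <> 0 -> 0 < induced_metric psi v v].

(* The vector metrically equivalent to df_p; it is unique when the metric is
   positive definite. *)
Definition grad (R : realType) (n : nat) (M : smoothManifold R n)
    (g : forall p : M, tangent p -> tangent p -> R) (f : M -> R) (p : M)
    : tangent p :=
  get [set v : tangent p | forall w : tangent p, g p v w = mdiff f w].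

Definition metric_norm (R : realType) (n : nat) (M : smoothManifold R n)
    (g : forall p : M, tangent p -> tangent p -> R) (p : M) (v : tangent p)
    : R :=
  Num.sqrt (g p v v).

(* A vector field along psi is a smooth map X : M -> L^4, where X p stands for
   a vector of T_(psi p) L^4 = L^4. *)
Definition lightlike_field (R : realType) (n : nat) (M : smoothManifold R n)
    (X : M -> 'rV[R]_4) : Prop :=
  (forall p, X p <> 0) /\ (forall p, lorentz (X p) (X p) = 0).

Definition normal_field (R : realType) (n : nat) (M : smoothManifold R n)
    (psi X : M -> 'rV[R]_4) : Prop :=
  forall (p : M) (w : tangent p), lorentz (X p) (mdiff psi w) = 0.

Definition lightlike_normal_field (R : realType) (n : nat)
    (M : smoothManifold R n) (psi X : M -> 'rV[R]_4) : Prop :=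
  [/\ smooth_map X, lightlike_field X & normal_field psi X].

(* Main.v *)
(** In any chart, [psi_* (grad psi_0)] is the unique vector X of the tangent
    plane with [<X, u> = u_0 = - <partial_0, u>] for all u in that plane. Hence
    [<X, X> = X_0] and [partial_0 + X] is normal, while differentiating
    [<psi, psi> = 0] makes psi normal; the identities for eta then follow by
    bilinearity. Cramer's rule in the frame of coordinate partials of an
    arbitrary chart exhibits X, and thus eta, as smooth. *)

From HB Require Import structures.
Require Import Defs.
From mathcomp Require Import all_boot all_order all_algebra.
From mathcomp Require Import all_classical all_reals all_analysis.
From mathcomp Require Import ring.
Import Order.TTheory GRing.Theory Num.Theory.
Import numFieldNormedType.Exports.
Local Open Scope classical_set_scope.
Local Open Scope ring_scope.

Set Implicit Arguments.
Unset Strict Implicit.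
Unset Printing Implicit Defensive.

(** * Calculus of [Ck_on] and [smooth_on] functions on open sets *)

Lemma near_eq_differentiable (R : realType) (V W : normedModType R)
    (f g : V -> W) (x : V) :
  (\near x, f x = g x) -> differentiable f x -> differentiable g x.
Proof.
move=> fg df.
have [dfc fE] := (diff_locallyP x f).1 df.
(* The first-order expansion of [f] at [x] is also one of [g], because the two functions agree near
   [x] and at [x]; uniqueness of the differential then identifies that of [g]. *)
have gE : g \o shift x = cst (g x) + 'd f x +o_ 0 id.
  apply/eqaddoP => _/posnumP[e].
  have /eqaddoP /(_ e%:num) /(_ [gt0 of e%:num]) := fE.
  have fgx : \forall h \near (0 : V), f (h + x) = g (h + x).
    move: fg; rewrite (near_shift 0) /=; apply: filterS => h /=.
    by rewrite subr0.
  apply: filter_app; near=> h => /=.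
  rewrite /= ![(_ + _ : _ -> _) _]/(_ + _) ![(- _ : _ -> _) _]/(- _) /=.
  by rewrite (nbhs_singleton fg) (near fgx h).
apply/diff_locallyP; have dgE := diff_unique dfc gE.
by rewrite dgE.
Unshelve. all: by end_near. Qed.

(** As [U] is open, equality on [U] is equality near each of its points, so it passes to directional
    derivatives and the induction continues. *)
Lemma Ck_on_eq (R : realType) (V W : normedModType R) (k : nat) (U : set V)
    (f g : V -> W) : open U -> (forall x, U x -> f x = g x) ->
  Ck_on k U f -> Ck_on k U g.
Proof.
move=> oU; elim: k f g => [|k IH] f g fg.
  move=> fc x Ux; rewrite /prop_for /continuous_at -(fg x Ux).
  apply: cvg_trans (fc x Ux); apply: near_eq_cvg.
  by apply: filterS (open_nbhs_nbhs (conj oU Ux)) => y /fg.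
have nfg x : U x -> \near x, f x = g x.
  by move=> Ux; apply: filterS (open_nbhs_nbhs (conj oU Ux)) => y /fg.
move=> [df Dk]; split=> [x Ux|v].
  exact: near_eq_differentiable (nfg x Ux) (df x Ux).
by apply: IH (Dk v) => x /nfg; exact: near_eq_derive.
Qed.

Lemma Ck_onW (R : realType) (V W : normedModType R) (k : nat) (U : set V)
    (f : V -> W) : Ck_on k.+1 U f -> Ck_on k U f.
Proof.
elim: k f => [|k IH] f [df Dk].
  by move=> x /df /differentiable_continuous.
by split=> // v; apply: IH.
Qed.

(** A continuous linear map is its own differential, so on [U] the derivative of [L \o f] along [v]
    is [L] applied to that of [f], and the induction applies. *)
Lemma Ck_on_linear (R : realType) (V W W' : normedModType R) (k : nat)
    (U : set V) (L : {linear W -> W'}) (f : V -> W) :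
  open U -> continuous L -> Ck_on k U f -> Ck_on k U (L \o f).
Proof.
move=> oU Lc; elim: k f => [|k IH] f.
  by move=> fc x Ux; apply: continuous_comp; [exact: fc | exact: Lc].
move=> [df Dk]; have dL y : differentiable L y by exact: linear_differentiable.
split=> [x Ux|v]; first by apply: differentiable_comp => //; exact: df.
apply: Ck_on_eq (IH _ (Dk v)) => // x Ux.
have dLf : differentiable (L \o f) x.
  by apply: differentiable_comp; [exact: df | exact: dL].
rewrite (deriveE _ dLf) (diff_comp (df x Ux) (dL (f x))) /=.
by rewrite (deriveE _ (df x Ux)) (diff_lin (f x) Lc).
Qed.

Lemma Ck_on_cst (R : realType) (V W : normedModType R) (k : nat)
    (U : set V) (w : W) : Ck_on k U (fun=> w).
Proof.
elim: k w => [|k IH] w /=; first by move=> x _; exact: cst_continuous.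
split=> // v.
have -> : (fun x => 'D_v (fun=> w) x) = (fun=> 0) :> (V -> W).
  by apply/funext => x; exact: derive_cst.
exact: IH.
Qed.

Lemma Ck_onD (R : realType) (V W : normedModType R) (k : nat)
    (U : set V) (f g : V -> W) : open U ->
  Ck_on k U f -> Ck_on k U g -> Ck_on k U (fun x => f x + g x).
Proof.
move=> oU; elim: k f g => [|k IH] f g.
  by move=> fc gc x Ux; apply: continuousD; [exact: fc | exact: gc].
move=> [df Df] [dg Dg].
split=> [x Ux|v]; first exact: differentiableD (df x Ux) (dg x Ux).
apply: Ck_on_eq (IH _ _ (Df v) (Dg v)) => // x Ux.
by rewrite -deriveD //; apply: diff_derivable; [exact: df | exact: dg].
Qed.

Lemma Ck_onM (R : realType) (V : normedModType R) (k : nat)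
    (U : set V) (f g : V -> R) : open U ->
  Ck_on k U f -> Ck_on k U g -> Ck_on k U (fun x => f x * g x).
Proof.
move=> oU; elim: k f g => [|k IH] f g.
  by move=> fc gc x Ux; apply: continuousM; [exact: fc | exact: gc].
move=> Cf Cg; have [[df Df] [dg Dg]] := (Cf, Cg).
split=> [x Ux|v]; first exact: differentiableM (df x Ux) (dg x Ux).
(* Leibniz rule: the undifferentiated factors, of class k+1, are weakened to class k to match the
   derivatives. *)
have := Ck_onD oU (IH _ _ (Ck_onW Cf) (Dg v)) (IH _ _ (Ck_onW Cg) (Df v)).
apply: Ck_on_eq => // x Ux.
by rewrite [RHS]deriveM //; apply: diff_derivable; [exact: df | exact: dg].
Qed.

Lemma Ck_onV (R : realType) (V : normedModType R) (k : nat)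
    (U : set V) (f : V -> R) : open U -> (forall x, U x -> f x != 0) ->
  Ck_on k U f -> Ck_on k U (fun x => (f x)^-1).
Proof.
move=> oU f0; elim: k => [|k IH] Cf.
  by move=> x Ux; apply: continuousV; [exact: f0 | exact: Cf].
have [df Df] := Cf.
split=> [x Ux|v]; first by apply: differentiableV; [exact: df | exact: f0].
have CV := IH (Ck_onW Cf).
(* The derivative of the inverse is [- f^-1 * f^-1 * 'D_v f], where [f^-1] is of class k by the
   induction hypothesis. *)
have := Ck_onM oU (Ck_on_cst k U (-1 : R)) (Ck_onM oU (Ck_onM oU CV CV) (Df v)).
apply: Ck_on_eq => // x Ux.
rewrite deriveV ?f0 //; last by apply: diff_derivable; exact: df.
by rewrite -invfM -expr2 mulN1r scaleNr.
Qed.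

(** A named function, so that a linear structure can be attached to it and [Ck_on_linear]
    applied. *)
Definition coord_mx (R : realType) (m n : nat) (i : 'I_m) (j : 'I_n)
    (N : 'M[R]_(m, n)) : R := N i j.

Lemma coord_mx_linear (R : realType) (m n : nat) (i : 'I_m) (j : 'I_n) :
  linear (@coord_mx R m n i j).
Proof. by move=> k N P; rewrite /coord_mx !mxE. Qed.

HB.instance Definition _ (R : realType) (m n : nat) (i : 'I_m) (j : 'I_n) :=
  GRing.isLinear.Build R 'M[R]_(m, n) R _ (@coord_mx R m n i j)
    (@coord_mx_linear R m n i j).

Lemma smooth_on_coord (R : realType) (V : normedModType R) (m n : nat)
    (U : set V) (f : V -> 'M[R]_(m.+1, n.+1)) i j : open U ->
  smooth_on U f -> smooth_on U (fun x => f x i j).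
Proof.
move=> oU sf k.
exact: (Ck_on_linear (L := @coord_mx R _ _ i j) oU
  (@coord_continuous _ _ _ i j) (sf k)).
Qed.

Lemma smooth_on_rV (R : realType) (V : normedModType R) (n : nat)
    (U : set V) (f : V -> 'rV[R]_n.+1) : open U ->
  (forall i, smooth_on U (fun x => f x 0 i)) -> smooth_on U f.
Proof.
move=> oU sf k.
pose e i : 'rV[R]_n.+1 := delta_mx 0 i.
(* Summing over an arbitrary list of indices allows induction on the list; each term is a scalar
   coordinate followed by the linear map scaling [e i]. *)
pose t (s : seq 'I_n.+1) x := \sum_(i <- s) f x 0 i *: e i.
suff Ct s : Ck_on k U (t s).
  by apply: Ck_on_eq (Ct (index_enum _)) => // x _; rewrite /t -row_sum_delta.
elim: s => [|i s IH].
  rewrite (_ : t [::] = fun=> 0); first exact: Ck_on_cst.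
  by apply/funext => x; rewrite /t big_nil.
rewrite (_ : t (i :: s) = fun x => f x 0 i *: e i + t s x).
  apply: Ck_onD => //.
  have Ll : linear ( *:%R ^~ (e i) : R -> 'rV[R]_n.+1).
    by move=> u y z; rewrite scalerDl scalerA.
  pose L : {linear R -> 'rV[R]_n.+1} :=
    HB.pack ( *:%R ^~ (e i))
      (GRing.isLinear.Build _ _ _ _ _ Ll).
  apply: (@Ck_on_linear _ _ _ _ _ _ L _ oU _ (sf i k)).
  exact: scalel_continuous.
by apply/funext => x; rewrite /t big_cons.
Qed.

Lemma smooth_on_eq (R : realType) (V W : normedModType R) (U : set V)
    (f g : V -> W) : open U -> (forall x, U x -> f x = g x) ->
  smooth_on U f -> smooth_on U g.
Proof. by move=> oU fg sf k; exact: Ck_on_eq (sf k). Qed.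

Lemma smooth_on_derive (R : realType) (V W : normedModType R) (U : set V)
    (f : V -> W) (v : V) : smooth_on U f -> smooth_on U ('D_v f).
Proof. by move=> sf k; exact: (sf k.+1).2. Qed.

Lemma smooth_on_differentiable (R : realType) (V W : normedModType R)
    (U : set V) (f : V -> W) x : smooth_on U f -> U x -> differentiable f x.
Proof. by move=> sf; exact: (sf 1%N).1. Qed.

Lemma smooth_on_cst (R : realType) (V W : normedModType R) (U : set V) (w : W) :
  smooth_on U (fun=> w).
Proof. by move=> k; exact: Ck_on_cst. Qed.

Section SmoothReal.
Variables (R : realType) (V : normedModType R) (U : set V) (oU : open U).
Implicit Types f g : V -> R.

Lemma smooth_onD f g : smooth_on U f -> smooth_on U g ->
  smooth_on U (fun x => f x + g x).
Proof. by move=> sf sg k; exact: Ck_onD. Qed.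

Lemma smooth_onM f g : smooth_on U f -> smooth_on U g ->
  smooth_on U (fun x => f x * g x).
Proof. by move=> sf sg k; exact: Ck_onM. Qed.

Lemma smooth_onN f : smooth_on U f -> smooth_on U (fun x => - f x).
Proof.
move=> sf; apply: smooth_on_eq (smooth_onM (smooth_on_cst U (-1 : R)) sf) => //.
by move=> x _; rewrite mulN1r.
Qed.

Lemma smooth_onB f g : smooth_on U f -> smooth_on U g ->
  smooth_on U (fun x => f x - g x).
Proof. by move=> sf /smooth_onN; exact: smooth_onD. Qed.

Lemma smooth_onV f : (forall x, U x -> f x != 0) -> smooth_on U f ->
  smooth_on U (fun x => (f x)^-1).
Proof. by move=> f0 sf k; exact: Ck_onV. Qed.

Lemma smooth_on_lorentz (F G : V -> 'rV[R]_4) : smooth_on U F ->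
  smooth_on U G -> smooth_on U (fun x => lorentz (F x) (G x)).
Proof.
move=> sF sG; have sFG i : smooth_on U (fun x => F x 0 i * G x 0 i).
  by apply: smooth_onM; apply: smooth_on_coord.
by do !apply: smooth_onD => //; apply: smooth_onN.
Qed.

End SmoothReal.

Lemma diff_coord (R : realType) (V : normedModType R) (m n : nat)
    (F : V -> 'M[R]_(m.+1, n.+1)) i j x v : differentiable F x ->
  'd (fun y => F y i j : R) x v = 'd F x v i j.
Proof.
move=> dF.
pose L := @coord_mx R m.+1 n.+1 i j.
have Lc : continuous L by exact: coord_continuous.
have dL : differentiable L (F x) by exact: linear_differentiable.
by rewrite -[LHS]/('d (L \o F) x v) (diff_comp dF dL) /= (diff_lin (F x) Lc).
Qed.

(** * Lorentz algebra, Gram determinants and Cramer's rule *)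

Section Lorentz.
Variable R : realType.
Implicit Types a b u v w : 'rV[R]_4.

Lemma lorentzC u v : lorentz u v = lorentz v u.
Proof. by rewrite /lorentz; ring. Qed.

Lemma lorentzDl u v w : lorentz (u + v) w = lorentz u w + lorentz v w.
Proof. by rewrite /lorentz !mxE; ring. Qed.

Lemma lorentzZl k u v : lorentz (k *: u) v = k * lorentz u v.
Proof. by rewrite /lorentz !mxE; ring. Qed.

Lemma lorentzDr u v w : lorentz u (v + w) = lorentz u v + lorentz u w.
Proof. by rewrite !(lorentzC u) lorentzDl. Qed.

Lemma lorentzZr k u v : lorentz u (k *: v) = k * lorentz u v.
Proof. by rewrite !(lorentzC u) lorentzZl. Qed.

Lemma lorentzBr u v w : lorentz u (v - w) = lorentz u v - lorentz u w.
Proof. by rewrite -scaleN1r lorentzDr lorentzZr mulN1r. Qed.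

Lemma lorentz_partial0 u : lorentz (partial0 R) u = - u 0 0.
Proof. by rewrite /lorentz /partial0 !mxE /=; ring. Qed.

Definition gram a b : R := lorentz a a * lorentz b b - lorentz a b ^+ 2.

(** The factor is the squared determinant of the change of frame; hence a nonzero Gram determinant
    of the new pair forces [gram a b] to be nonzero. *)
Lemma gram_comb a b (x y z t : R) :
  gram (x *: a + y *: b) (z *: a + t *: b) = (x * t - y * z) ^+ 2 * gram a b.
Proof.
rewrite /gram !(lorentzDl, lorentzDr, lorentzZl, lorentzZr) (lorentzC b a).
by ring.
Qed.

Lemma gram_gt0 a b :
  (forall x y : R, (x != 0) || (y != 0) ->
     0 < lorentz (x *: a + y *: b) (x *: a + y *: b)) -> 0 < gram a b.
Proof.
move=> pos.
have b0 : 0 < lorentz b b.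
  by have := pos 0 1; rewrite scale0r scale1r add0r oner_eq0 orbT; apply.
(* Gram-Schmidt without division: this combination is orthogonal to [b], and its square is
   [lorentz b b * gram a b]. *)
have := pos (lorentz b b) (- lorentz a b); rewrite (gt_eqF b0) => /(_ isT).
rewrite !(lorentzDl, lorentzDr, lorentzZl, lorentzZr) (lorentzC b a).
set E := _ + _; have -> : E = lorentz b b * gram a b by rewrite /E /gram; ring.
by rewrite pmulr_rgt0.
Qed.

(* Cramer's rule for the vector of the plane spanned by a and b representing
   the linear form u |-> u_0 on this plane. *)
Definition coord0_rep a b : 'rV[R]_4 :=
  ((lorentz b b * a 0 0 - lorentz a b * b 0 0) / gram a b) *: a
  + ((lorentz a a * b 0 0 - lorentz a b * a 0 0) / gram a b) *: b.

Lemma coord0_repP a b (x y : R) : gram a b != 0 ->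
  lorentz (coord0_rep a b) (x *: a + y *: b) = (x *: a + y *: b) 0 0.
Proof.
move=> ab0; rewrite !(lorentzDl, lorentzDr, lorentzZl, lorentzZr).
by rewrite (lorentzC b a) !mxE; move: ab0; rewrite /gram => ab0; field.
Qed.

(** With [a 0 0] and [b 0 0] replaced by the products of [u] with [a] and [b], the Cramer quotients
    return the coefficients [x] and [y] of [u]. *)
Lemma coord0_rep_unique a b u (x y : R) : gram a b != 0 ->
  u = x *: a + y *: b -> lorentz u a = a 0 0 -> lorentz u b = b 0 0 ->
  u = coord0_rep a b.
Proof.
move=> ab0 uE; rewrite /coord0_rep => <- <-; rewrite uE.
rewrite !(lorentzDl, lorentzZl) (lorentzC b a).
by congr (_ *: _ + _ *: _); move: ab0; rewrite /gram => ab0; field.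
Qed.

End Lorentz.

(** Each coordinate is a rational expression in smooth functions whose only denominator is the Gram
    determinant. *)
Lemma smooth_on_coord0_rep (R : realType) (V : normedModType R) (U : set V)
    (a b : V -> 'rV[R]_4) i : open U ->
  (forall x, U x -> gram (a x) (b x) != 0) ->
  smooth_on U a -> smooth_on U b ->
  smooth_on U (fun x => coord0_rep (a x) (b x) 0 i).
Proof.
move=> oU ab0 sa sb.
have saa := smooth_on_lorentz oU sa sa; have sbb := smooth_on_lorentz oU sb sb.
have sab := smooth_on_lorentz oU sa sb.
have sG : smooth_on U (fun x => (gram (a x) (b x))^-1).
  apply: smooth_onV => //; apply: smooth_onB => //; first exact: smooth_onM.
  exact: smooth_onM.
have sai j := smooth_on_coord 0 j oU sa.
have sbi j := smooth_on_coord 0 j oU sb.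
apply: (@smooth_on_eq _ _ _ _ (fun x =>
  (lorentz (b x) (b x) * a x 0 0 - lorentz (a x) (b x) * b x 0 0)
    * (gram (a x) (b x))^-1 * a x 0 i
  + (lorentz (a x) (a x) * b x 0 0 - lorentz (a x) (b x) * a x 0 0)
    * (gram (a x) (b x))^-1 * b x 0 i)) => //.
  by move=> x _; rewrite !mxE.
by apply: smooth_onD => //; apply: smooth_onM => //; apply: smooth_onM => //;
   apply: smooth_onB => //; apply: smooth_onM.
Qed.

(** By symmetry the derivative of [lorentz (F y) (F y)] is twice the product of [F] with its
    derivative, and the derivative of a locally zero function vanishes. *)
Lemma lorentz_derive_null (R : realType) (V : normedModType R)
    (F : V -> 'rV[R]_4) x v : differentiable F x ->
  (\near x, lorentz (F x) (F x) = 0) -> lorentz (F x) ('d F x v) = 0.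
Proof.
move=> dF F0.
pose Fi i y : R := F y 0 i.
have dFi i : differentiable (Fi i) x.
  by apply: (@differentiable_comp _ _ _ _ F (fun N : 'rV[R]_4 => N 0 i)) => //;
     exact: differentiable_coord.
have dvi i : derivable (Fi i) x v by exact: diff_derivable.
have dvii i : derivable (Fi i * Fi i) x v by exact: derivableM (dvi i) (dvi i).
have Di i : 'D_v (Fi i) x = 'd F x v 0 i by rewrite deriveE // diff_coord.
have Dii i : is_derive x v (Fi i * Fi i) (2 * (Fi i x * 'd F x v 0 i)).
  apply: DeriveDef => //; rewrite deriveM // Di -[_ *: _]/(_ * _); ring.
have := near_eq_derive v F0; rewrite derive_cst.
have DE := is_deriveD (is_deriveD (is_deriveD (is_deriveN (Dii 0)) (Dii 1))
  (Dii 2%:R)) (Dii 3%:R).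
have -> : 'D_v (fun y => lorentz (F y) (F y)) x = _ :=
  @derive_val _ _ _ _ _ _ _ DE.
set L := lorentz _ _; move=> E.
have : 2 * L = 0 by rewrite -E /L /lorentz /Fi; ring.
by move=> /eqP; rewrite mulf_eq0 pnatr_eq0 /= => /eqP.
Qed.

Lemma diff_rV2 (R : realType) (W : normedModType R) (F : 'rV[R]_2 -> W) x v :
  'd F x v = v 0 0 *: 'd F x (delta_mx 0 0) + v 0 1 *: 'd F x (delta_mx 0 1).
Proof.
rewrite -!linearZ -linearD {1}[v]row_sum_delta !big_ord_recl big_ord0 addr0.
by have -> : lift ord0 ord0 = 1 :> 'I_2 by exact: val_inj.
Qed.

(** * Differentials read in different charts *)

Section ManifoldDifferential.
Variables (R : realType) (n : nat) (M : smoothManifold R n).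

Lemma chart_at_atlas (p : M) : atlas (s := M) (chart_at p).
Proof. by rewrite /chart_at; case: cid2. Qed.

Lemma chart_at_dom (p : M) : chart_dom (chart_at p) p.
Proof. by rewrite /chart_at; case: cid2. Qed.

Lemma near_chart_inv (c : chart R n M) (p : M) (A : set M) : chart_dom c p ->
  open A -> A p -> \forall x \near c p, A (chart_inv c x).
Proof.
move=> cp oA Ap; apply: (chart_inv_continuous (c := c) (x := c p)).
  by exists p.
by rewrite chart_mapK //; exact: open_nbhs_nbhs.
Qed.

Lemma smooth_map_differentiable (W : normedModType R) (f : M -> W)
    (c : chart R n M) (p : M) : smooth_map f -> atlas c -> chart_dom c p ->
  differentiable (f \o chart_inv c) (c p).
Proof.
by move=> sf ac cp; apply: smooth_on_differentiable (sf c ac) _; exists p.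
Qed.

(** Chain rule for the transition map, whose differential sends [v] to [w]. This links [mdiff], tied
    to [chart_at p], with the arbitrary charts in which smoothness is tested. *)
Lemma diff_chart_change (W : normedModType R) (f : M -> W)
    (c c' : chart R n M) (p : M) (v : 'rV[R]_n) :
    smooth_map f -> atlas c -> atlas c' -> chart_dom c p -> chart_dom c' p ->
  exists w, 'd (f \o chart_inv c) (c p) v = 'd (f \o chart_inv c') (c' p) w.
Proof.
move=> sf ac ac' cp c'p.
pose tau := c' \o chart_inv c; pose F' := f \o chart_inv c'.
have tp : tau (c p) = c' p by rewrite /tau /= chart_mapK.
have dt : differentiable tau (c p).
  by apply: smooth_on_differentiable (atlas_compat ac ac') _; exists p.
have dF' : differentiable F' (tau (c p)).
  by rewrite tp; exact: smooth_map_differentiable.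
have E : \forall x \near c p, (F' \o tau) x = (f \o chart_inv c) x.
  have := near_chart_inv cp (chart_dom_open c') c'p; apply: filterS => x c'x.
  by rewrite /F' /tau /= chart_mapK.
exists ('d tau (c p) v).
have dFt : differentiable (F' \o tau) (c p) by exact: differentiable_comp.
have dF : differentiable (f \o chart_inv c) (c p).
  exact: smooth_map_differentiable.
(* The factorization holds only near [c p], so differentials are compared through directional
   derivatives, which depend on germs alone. *)
apply: etrans (esym (deriveE v dF)) _.
apply: etrans (esym (@near_eq_derive _ _ _ (F' \o tau) _ _ v E)) _.
apply: etrans (deriveE v dFt) _.
apply: etrans (congr1 (fun h => h v) (diff_comp dt dF')) _.
by rewrite /= -/F' tp.
Qed.

End ManifoldDifferential.

(** One chart is kept fixed while the point varies, so the result is a function of the coordinates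
    whose smoothness makes sense; [mdiff] changes chart with the point. *)
Definition chart_partial (R : realType) (n : nat) (M : topologicalType)
    (W : normedModType R) (f : M -> W) (c : chart R n M) (i : 'I_n) :
    'rV[R]_n -> W :=
  'D_(delta_mx 0 i) (f \o chart_inv c).

(** * Tangent planes, gradient of the height and normality of the position vector *)

Section LightconeSurface.
Variables (R : realType) (M : smoothManifold R 2) (psi : M -> 'rV[R]_4).
Hypothesis psi_spacelike : spacelike_surface psi.

Let psi_smooth : smooth_map psi. Proof. by case: psi_spacelike. Qed.

Lemma diff_chart_partial (c : chart R 2 M) (p : M) (v : 'rV[R]_2) :
    atlas c -> chart_dom c p ->
  'd (psi \o chart_inv c) (c p) v =
    v 0 0 *: chart_partial psi c 0 (c p) + v 0 1 *: chart_partial psi c 1 (c p).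
Proof.
move=> ac cp; rewrite diff_rV2 /chart_partial !deriveE //;
  exact: smooth_map_differentiable.
Qed.

Lemma mdiffE (p : M) (v : tangent p) : mdiff psi v =
  v 0 0 *: chart_partial psi (chart_at p) 0 (chart_at p p)
  + v 0 1 *: chart_partial psi (chart_at p) 1 (chart_at p p).
Proof. exact: diff_chart_partial (chart_at_atlas p) (chart_at_dom p). Qed.

Lemma mdiff_chart_partial (c : chart R 2 M) (p : M) (w : tangent p) :
    atlas c -> chart_dom c p ->
  exists x y, mdiff psi w =
    x *: chart_partial psi c 0 (c p) + y *: chart_partial psi c 1 (c p).
Proof.
move=> ac cp; have [v] := diff_chart_change w psi_smooth (chart_at_atlas p) ac
  (chart_at_dom p) cp.
move=> E; exists (v 0 0), (v 0 1); apply: etrans E _.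
exact: diff_chart_partial.
Qed.

(** Together with [mdiff_chart_partial], this shows that the partials in any chart around [p] span
    exactly the image of [mdiff psi] at [p]. *)
Lemma chart_partial_mdiff (c : chart R 2 M) (p : M) (i : 'I_2) :
    atlas c -> chart_dom c p ->
  exists w : tangent p, chart_partial psi c i (c p) = mdiff psi w.
Proof.
move=> ac cp; have [w E] := diff_chart_change (delta_mx 0 i) psi_smooth ac
  (chart_at_atlas p) cp (chart_at_dom p).
exists w; apply: etrans E; apply: deriveE.
exact: smooth_map_differentiable.
Qed.

(** Spacelikeness gives positivity in [chart_at p]; the partials there are combinations of those in
    [c], so [gram_comb] carries nonvanishing over to [c]. *)
Lemma gram_chart_partial_neq0 (c : chart R 2 M) (p : M) :
    atlas c -> chart_dom c p ->
  gram (chart_partial psi c 0 (c p)) (chart_partial psi c 1 (c p)) != 0.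
Proof.
move=> ac cp; set q := chart_at p.
have : 0 < gram (chart_partial psi q 0 (q p)) (chart_partial psi q 1 (q p)).
  apply: gram_gt0 => x y xy0.
  pose v : tangent p := \row_(i < 2) (if i == 0 then x else y).
  have <- : mdiff psi v = x *: chart_partial psi q 0 (q p)
      + y *: chart_partial psi q 1 (q p).
    by rewrite mdiffE !mxE.
  have [_ _ _ pos] := psi_spacelike; apply: pos => v0.
  by case/orP: xy0 => /eqP; apply; [have := congr1 (fun u : 'rV_2 => u 0 0) v0
    | have := congr1 (fun u : 'rV_2 => u 0 1) v0]; rewrite !mxE.
have [w wE] := chart_partial_mdiff 0 (chart_at_atlas p) (chart_at_dom p).
have [w' w'E] := chart_partial_mdiff 1 (chart_at_atlas p) (chart_at_dom p).
have [x [y E]] := mdiff_chart_partial w ac cp.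
have [z [t E']] := mdiff_chart_partial w' ac cp.
rewrite wE w'E E E' gram_comb => /lt0r_neq0.
by rewrite mulf_eq0 negb_or => /andP[].
Qed.

Lemma mdiff_coord0 (p : M) (w : tangent p) :
  mdiff (fun p : M => psi p 0 0 : R) w = mdiff psi w 0 0.
Proof.
apply: (diff_coord (F := psi \o chart_inv (chart_at p))).
apply: smooth_map_differentiable => //; first exact: chart_at_atlas.
exact: chart_at_dom.
Qed.

Lemma grad_coord0P (p : M) (w : tangent p) :
  lorentz (mdiff psi (grad (@induced_metric R 2 M psi)
    (fun p : M => psi p 0 0 : R) p)) (mdiff psi w) = mdiff psi w 0 0.
Proof.
rewrite -mdiff_coord0.
set S := [set v : tangent p | forall w : tangent p,
  induced_metric psi v w = mdiff (fun p : M => psi p 0 0 : R) w].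
(* [grad] is a choice by [get], which satisfies the defining property once some vector does. *)
suff [v Sv] : exists v, S v by have := getPex (ex_intro _ v Sv); apply.
have [aq pq] := (chart_at_atlas p, chart_at_dom p).
have ab0 := gram_chart_partial_neq0 aq pq.
set q := chart_at p; set a := chart_partial psi q 0 (q p).
set b := chart_partial psi q 1 (q p).
(* The witness has as components the Cramer coefficients of [coord0_rep a b]. *)
pose x := (lorentz b b * a 0 0 - lorentz a b * b 0 0) / gram a b.
pose y := (lorentz a a * b 0 0 - lorentz a b * a 0 0) / gram a b.
pose v : tangent p := \row_(i < 2) (if i == 0 then x else y).
have vE : mdiff psi v = coord0_rep a b by rewrite mdiffE !mxE.
exists v => u.
by rewrite /induced_metric mdiff_coord0 vE mdiffE coord0_repP.
Qed.

(** Replaces the pointwise choice in [grad] by a formula valid throughout the domain of one chart,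
    from which smoothness can be read off. *)
Lemma grad_coord0E (c : chart R 2 M) (p : M) : atlas c -> chart_dom c p ->
  mdiff psi (grad (@induced_metric R 2 M psi) (fun p : M => psi p 0 0 : R) p) =
  coord0_rep (chart_partial psi c 0 (c p)) (chart_partial psi c 1 (c p)).
Proof.
move=> ac cp; set v := grad _ _ _.
have [x [y E]] := mdiff_chart_partial v ac cp.
have H i : lorentz (mdiff psi v) (chart_partial psi c i (c p)) =
    chart_partial psi c i (c p) 0 0.
  by have [w ->] := chart_partial_mdiff i ac cp; exact: grad_coord0P.
exact: coord0_rep_unique (gram_chart_partial_neq0 ac cp) E (H _) (H _).
Qed.

Lemma metric_norm_sqr (p : M) (v : tangent p) :
  metric_norm (@induced_metric R 2 M psi) v ^+ 2 =
  lorentz (mdiff psi v) (mdiff psi v).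
Proof.
(* The square root squares back only for a nonnegative argument; spacelikeness covers nonzero
   vectors, so zero is treated apart. *)
apply: sqr_sqrtr; have [->|/eqP v0] := eqVneq v 0.
  by rewrite /induced_metric /mdiff linear0 /lorentz !mxE !mulr0 oppr0 !addr0.
by have [_ _ _ pos] := psi_spacelike; exact/ltW/pos.
Qed.

Lemma position_normal : range psi `<=` @future_lightcone R ->
  normal_field psi psi.
Proof.
move=> cone p w; set c := chart_at p.
have <- : (psi \o chart_inv c) (c p) = psi p.
  by rewrite /= chart_mapK //; exact: chart_at_dom.
apply: lorentz_derive_null.
  apply: smooth_map_differentiable => //; first exact: chart_at_atlas.
  exact: chart_at_dom.
by near=> x; have [] := cone (psi (chart_inv c x)) (imageT _ _).
Unshelve. all: by end_near. Qed.

End LightconeSurface.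

(** * The two lightlike normal fields: algebraic identities, then smoothness *)

Theorem lemma3p2 (R : realType) (M : smoothManifold R 2)
    (psi : M -> 'rV[R]_4) (psi_spacelike : spacelike_surface psi)
    (psi_lightcone : range psi `<=` @future_lightcone R) :
  let psi0 := fun p : M => psi p 0 0 in
  let g := @induced_metric R 2 M psi in
  let grad_psi0 := grad g psi0 in
  let xi := psi in
  let eta := fun p : M =>
    ((1 + metric_norm g (grad_psi0 p) ^+ 2) / (2%:R * psi0 p ^+ 2)) *: xi p
    - (psi0 p)^-1 *: (partial0 R + mdiff psi (grad_psi0 p)) in
  [/\ lightlike_normal_field psi xi,
      lightlike_normal_field psi eta &
      forall p : M, lorentz (xi p) (eta p) = 1].
Proof.
move=> psi0 g grad_psi0 xi eta.
have psi_smooth : smooth_map psi by case: psi_spacelike.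
have psi_null p : lorentz (psi p) (psi p) = 0.
  by have [] := psi_lightcone (psi p) (imageT _ _).
have psi0_gt0 p : 0 < psi0 p.
  by have [] := psi_lightcone (psi p) (imageT _ _).
have psi0_neq0 p : psi0 p != 0 by rewrite gt_eqF.
have lorentz0v (v : 'rV[R]_4) : lorentz 0 v = 0.
  by rewrite -(scale0r v) lorentzZl mul0r.
have psi_normal := position_normal psi_spacelike psi_lightcone.
pose X p := mdiff psi (grad_psi0 p).
have XP p (w : tangent p) : lorentz (X p) (mdiff psi w) = mdiff psi w 0 0.
  exact: grad_coord0P.
have XX p : lorentz (X p) (X p) = X p 0 0 by exact: XP.
have psiX p : lorentz (psi p) (X p) = 0 by exact: psi_normal.
have XE c p (ac : atlas c) (cp : chart_dom c p) : X p =
    coord0_rep (chart_partial psi c 0 (c p)) (chart_partial psi c 1 (c p)).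
  exact: grad_coord0E.
have etaE p : eta p = ((1 + X p 0 0) / (2%:R * psi0 p ^+ 2)) *: psi p
    - (psi0 p)^-1 *: (partial0 R + X p).
  by rewrite -XX -metric_norm_sqr.
clearbody eta X.
have lorentz_etal p v : lorentz (eta p) v =
    (1 + X p 0 0) / (2%:R * psi0 p ^+ 2) * lorentz (psi p) v
    - (psi0 p)^-1 * (- v 0 0 + lorentz (X p) v).
  by rewrite etaE lorentzC lorentzBr !lorentzZr !(lorentzC v) lorentzDl
     lorentz_partial0.
have xi_eta p : lorentz (xi p) (eta p) = 1.
  (* Only the contribution of [partial0] survives: it is [psi0 p] divided by itself. *)
  rewrite lorentzC lorentz_etal psi_null (lorentzC (X p)) psiX.
  by move: (psi0_neq0 p); rewrite /psi0 => ?; field.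
have eta_eta p : lorentz (eta p) (eta p) = 0.
  (* Here [eta] is orthogonal to [X], since [XX] cancels the [partial0] term. With C the coefficient
     of [psi] in [eta], what remains is C plus the quotient of the 0-th coordinate of [eta] by
     [psi0], that is 2C minus [(1 + X p 0 0) / psi0 p ^+ 2], which is zero. *)
  rewrite lorentz_etal (xi_eta p) (lorentzC (X p)) lorentz_etal psiX XX.
  rewrite etaE !mxE /=; move: (psi0_neq0 p); rewrite /psi0 => ?; by field.
split; [split => //|split => //|by []].
- split=> p; last exact: psi_null.
  by move=> p0; have := psi0_gt0 p; rewrite /psi0 (p0 : psi p = 0) mxE ltxx.
- move=> c ac.
  pose U := chart_codom c; have oU : open U by exact: chart_codom_open.
  pose a := chart_partial psi c 0; pose b := chart_partial psi c 1.
  have sPsi : smooth_on U (psi \o chart_inv c) by exact: psi_smooth.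
  have [sa sb] : smooth_on U a /\ smooth_on U b.
    by split; exact: smooth_on_derive.
  have ab0 x : U x -> gram (a x) (b x) != 0.
    by move=> [p cp <-]; exact: gram_chart_partial_neq0.
  have sX i := smooth_on_coord0_rep i oU ab0 sa sb.
  have spsi i := smooth_on_coord 0 i oU sPsi.
  have sinv : smooth_on U (fun x => ((psi \o chart_inv c) x 0 0)^-1).
    by apply: smooth_onV => // x _; exact: psi0_neq0.
  apply: smooth_on_rV => // i.
  (* The i-th coordinate of [eta] in the chart [c], with [X] in Cramer form and the quotients
     written as products of inverses. *)
  apply: (@smooth_on_eq _ _ _ _ (fun x =>
    (1 + coord0_rep (a x) (b x) 0 0) * (2%:R^-1 *
      (((psi \o chart_inv c) x 0 0)^-1 * ((psi \o chart_inv c) x 0 0)^-1))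
      * (psi \o chart_inv c) x 0 i
    - ((psi \o chart_inv c) x 0 0)^-1 *
      (partial0 R 0 i + coord0_rep (a x) (b x) 0 i))) => //.
    move=> x [p cp <-]; rewrite [in RHS]/comp /comp chart_mapK // etaE.
    rewrite (XE c p ac cp) -/(a _) -/(b _).
    move: (coord0_rep _ _) => Y; rewrite !mxE.
    by rewrite invfM expr2 invfM.
  apply: smooth_onB => //; apply: smooth_onM => //.
    apply: smooth_onM => //.
      by apply: smooth_onD => //; exact: smooth_on_cst.
    by apply: smooth_onM; [|exact: smooth_on_cst|exact: smooth_onM].
  by apply: smooth_onD => //; exact: smooth_on_cst.
- split=> p; last exact: eta_eta.
  (* A zero of [eta] would contradict its product 1 with [xi]. *)
  by move=> e0; move: (xi_eta p); rewrite e0 lorentzC lorentz0v => /eqP;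
     rewrite eq_sym oner_eq0.
(* On a tangent vector, the products with [partial0] and with [X] are opposite 0-th coordinates, and
   [psi] is normal. *)
- by move=> p w; rewrite lorentz_etal psi_normal XP mulr0 addNr mulr0 subr0.
Qed.
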